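(* For any fixed admissible control $u=(\theta_1,\theta_2,\pi_1,\pi_2,C_1,C_2,L_1,L_2)$ with $\theta_i(t)\in(0,1)$ (for $i=1,2$), there exists an admissible control of the form $u_0=(1,1,\pi_1^0,\pi_2^0,C_1^0,C_2^0,L_1^0,L_2^0)$ such that $$J(x_1,x_2;u)\le J(x_1,x_2;u_0).$$
   Context: Let $W_1,W_2$ be independent standard Brownian motions on a complete probability space with a right-continuous, completed filtration $\mathbb F$. For $i=1,2$ let $\kappa_i>0$ and let $F_i$ be the distribution function of a nonnegative random variable with finite first and second moments; $\overline F_i:=1-F_i$, $M_i:=\inf\{y\ge0:\overline F_i(y)=0\}\le\infty$, $\mu_i(s):=\int_0^s\overline F_i(y)dy$, $\sigma_i^2(s):=\int_0^s2y\overline F_i(y)dy$, $\sigma_i\ge0$. Let $\delta>0$ and $a\in[0,1]$. A control $u=(\theta_1,\theta_2,\pi_1,\pi_2,C_1,C_2,L_1,L_2)$ is admissible if it is $\mathbb F$-adapted, $\theta_i(t)\in(0,1]$ and $\pi_i(t)\in[0,M_i]$ for $i=1,2$, $t\ge0$, and $C_i,L_i$ are nonnegative, nondecreasing, right-continuous with left limits. Here $\theta_i$ is the proportional retention, $\pi_i$ the excess-of-loss retention, $C_i$ the cumulative dividends of Line $i$, and $L_i$ the cumulative capital transferred to Line $i$ from Line $3-i$. The controlled reserves satisfy $X_i(0)=x_i\ge0$ and $$dX_i(t)=\kappa_i\theta_i(t)\mu_i\Big(\tfrac{\pi_i(t)}{\theta_i(t)}\Big)dt+\theta_i(t)\sigma_i\Big(\tfrac{\pi_i(t)}{\theta_i(t)}\Big)dW_i(t)-dC_i(t)+dL_i(t)-dL_{3-i}(t).$$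 With $\tau:=\inf\{t\ge0:\min\{X_1(t),X_2(t)\}<0\}$, $$J(x_1,x_2;u):=\mathbb E\Big[a\int_0^\tau e^{-\delta t}dC_1(t)+(1-a)\int_0^\tau e^{-\delta t}dC_2(t)\Big].$$ *)

(* Defs.v *)
From HB Require Import structures.
From mathcomp Require Import all_boot all_order all_algebra.
From mathcomp Require Import all_classical all_reals all_analysis.
From mathcomp Require Import measurable_realfun.

Set Implicit Arguments.
Unset Strict Implicit.
Unset Printing Implicit Defensive.

Import Order.TTheory GRing.Theory Num.Theory.
Import numFieldNormedType.Exports.

Local Open Scope classical_set_scope.
Local Open Scope ring_scope.

(* Processes are functions [R -> T -> _]; only their values at times [t >= 0]
   matter.  The two business lines are indexed by ['I_2], and [rev_ord i] is
   the line other than [i]. *)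

Section stochastic_basis.
Context {R : realType} {d : measure_display} {T : measurableType d}.
Variables (P : probability T R) (F : R -> set (set T)).

Definition usual_filtration : Prop :=
  [/\ forall t, 0 <= t -> sigma_algebra setT (F t) /\ F t `<=` measurable,
      forall s t, 0 <= s -> s <= t -> F s `<=` F t,
      forall s, 0 <= s -> \bigcap_(t in [set t | s < t]) F t `<=` F s &
      P.-negligible `<=` F 0].

Definition sub_measurable {d'} {E : measurableType d'} (G : set (set T))
  (f : T -> E) : Prop := forall B, measurable B -> G (f @^-1` B).

Definition adapted {d'} {E : measurableType d'} (X : R -> T -> E) : Prop :=
  forall t, 0 <= t -> sub_measurable (F t) (X t).

(* For every t, (s, w) |-> X s w restricted to [0, t] x T is measurable with
   respect to the product of the Borel sets and F t. *)
Definition progressive {d'} {E : measurableType d'} (X : R -> T -> E) : Prop :=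
  forall t, 0 <= t -> forall B, measurable B ->
    <<s [set A `*` G | A in (@measurable _ (measurableTypeR R)) & G in F t] >>
      [set sw | 0 <= sw.1 <= t /\ B (X sw.1 sw.2)].

Definition brownian_motion (W : R -> T -> R) : Prop :=
  [/\ adapted W,
      {ae P, forall w, W 0 w = 0},
      {ae P, forall w, {within `[0, +oo[, continuous (W^~ w)}} &
      forall s t, 0 <= s -> s < t -> forall B : set R, measurable B ->
        let D := [set w | B (W t w - W s w)] in
        P D = normal_prob 0 (Num.sqrt (t - s)) B /\
        forall A, F s A -> (P (A `&` D) = P A * P D)%E].

Definition process_sigma (X : R -> T -> R) : set (set T) :=
  <<s [set A | exists2 t, 0 <= t &
        exists2 B : set R, measurable B & A = X t @^-1` B] >>.

Definition independent_processes (X Y : R -> T -> R) : Prop :=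
  forall A B, process_sigma X A -> process_sigma Y B ->
    P (A `&` B) = (P A * P B)%E.

(* The simple process sum_(k < len) coef_k 1_(time_k, time_(k+1)]. *)
Record simple_process := SimpleProcess {
  sp_len : nat ;
  sp_time : nat -> R ;
  sp_coef : nat -> T -> R }.

Definition simple_predictable (S : simple_process) : Prop :=
  forall k, [/\ 0 <= sp_time S k <= sp_time S k.+1,
    sub_measurable (F (sp_time S k)) (sp_coef S k) &
    exists c, forall w, `|sp_coef S k w| <= c].

Definition sp_value (S : simple_process) (s : R) (w : T) : R :=
  \sum_(k < sp_len S) sp_coef S k w * \1_`]sp_time S k, sp_time S k.+1] s.

Definition sp_integral (S : simple_process) (W : R -> T -> R) (t : R) (w : T) :
    R :=
  \sum_(k < sp_len S) sp_coef S k w *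
    (W (Num.min t (sp_time S k.+1)) w - W (Num.min t (sp_time S k)) w).

(* [Z] is the continuous version of the Ito integral int_0^t H dW of a
   progressive [H] with E int_0^t H^2 ds < oo: the L^2 limit of the integrals
   of simple processes converging to [H] in L^2([0, t] x T). *)
Definition ito_integral (W H Z : R -> T -> R) : Prop :=
  [/\ adapted Z,
      {ae P, forall w, {within `[0, +oo[, continuous (Z^~ w)}} &
      forall t : R, 0 <= t -> exists S : nat -> simple_process,
        [/\ forall n, simple_predictable (S n),
            (\int[P]_w \int[@lebesgue_measure R]_(s in `[0%R, t])
               ((sp_value (S n) s w - H s w) ^+ 2)%:E)%E @[n --> \oo] --> 0%E &
            (\int[P]_w ((sp_integral (S n) W t w - Z t w) ^+ 2)%:E)%E
               @[n --> \oo] --> 0%E]].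

End stochastic_basis.

Section claims.
Context {R : realType}.

Definition survival {d : measure_display} {S : measurableType d}
  (Q : probability S R) (Y : {RV Q >-> R}) (y : R) : R := 1 - fine (cdf Y y).

Variable Fbar : R -> R.

Definition claim_max : \bar R :=
  ereal_inf [set y%:E | y in [set y | 0 <= y /\ Fbar y = 0]].

(* The upper limit [s] may be +oo. *)
Definition mu_of (s : \bar R) : R :=
  \int[@lebesgue_measure R]_(y in [set y | 0 <= y /\ (y%:E <= s)%E]) Fbar y.

Definition sigma_of (s : \bar R) : R :=
  Num.sqrt (\int[@lebesgue_measure R]_(y in [set y | 0 <= y /\ (y%:E <= s)%E])
              (2 * y * Fbar y)).

End claims.

Section control_problem.
Context {R : realType} {d : measure_display} {T : measurableType d}.
Variables (P : probability T R) (F : R -> set (set T)) (W : 'I_2 -> R -> T -> R).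
Variables (kappa : 'I_2 -> R) (Fbar : 'I_2 -> R -> R).

(* Paths of [C] and [L] are nondecreasing and right-continuous by typing.
   The type [cumulative] wants paths on the whole line; their values at
   negative times are never used. *)
Record control := Control {
  theta : 'I_2 -> R -> T -> R ;
  retention : 'I_2 -> R -> T -> \bar R ;
  dividend : 'I_2 -> T -> cumulative R R ;
  transfer : 'I_2 -> T -> cumulative R R }.

(* The regular strategies are required to be progressive, which is what the
   dt- and dW-integrals of an adapted strategy need; for the right-continuous
   processes C and L this is the same as adapted. *)
Definition admissible (u : control) : Prop :=
  forall i,
    [/\ progressive F (theta u i) /\ progressive F (retention u i),
        forall t w, 0 <= t -> 0 < theta u i t w <= 1,
        forall t w, 0 <= t ->
          (0 <= retention u i t w <= claim_max (Fbar i))%E,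
        adapted F (fun t w => dividend u i w t) /\
          adapted F (fun t w => transfer u i w t) &
        forall t w, 0 <= t -> 0 <= dividend u i w t /\ 0 <= transfer u i w t].

Definition excess_level (u : control) (i : 'I_2) (t : R) (w : T) : \bar R :=
  (retention u i t w * ((theta u i t w)^-1)%:E)%E.

Definition drift (u : control) (i : 'I_2) (t : R) (w : T) : R :=
  kappa i * theta u i t w * mu_of (Fbar i) (excess_level u i t w).

Definition volatility (u : control) (i : 'I_2) (t : R) (w : T) : R :=
  theta u i t w * sigma_of (Fbar i) (excess_level u i t w).

(* All dC- and dL-integrals run over (0, t], so that X(0) = x and the initial
   values C(0), L(0) play no role. *)
Definition increment (A : T -> cumulative R R) (t : R) (w : T) : R :=
  A w t - A w 0.

Definition controlled_reserve (x : 'I_2 -> R) (u : control)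
    (X : 'I_2 -> R -> T -> R) : Prop :=
  exists Z : 'I_2 -> R -> T -> R,
    (forall i, ito_integral P F (W i) (volatility u i) (Z i)) /\
    {ae P, forall w, forall i t, 0 <= t ->
      X i t w = x i
        + \int[@lebesgue_measure R]_(s in `[0, t]) drift u i s w
        + Z i t w
        - increment (dividend u i) t w
        + increment (transfer u i) t w
        - increment (transfer u (rev_ord i)) t w}.

(* The reserve controlled by [u]; it exists, as the volatility is bounded, and
   is unique up to indistinguishability. *)
Definition reserve (x : 'I_2 -> R) (u : control) : 'I_2 -> R -> T -> R :=
  xget (fun _ _ _ => 0) (controlled_reserve x u).

Definition ruin_time (X : 'I_2 -> R -> T -> R) (w : T) : \bar R :=
  ereal_inf [set t%:E | t in
    [set t | 0 <= t /\ Num.min (X ord0 t w) (X ord_max t w) < 0]].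

(* An admissible control may pay more than the current reserve at a time tau
   and be ruined by that very payment; the boolean says whether a payment made
   at tau is collected.
   int_0^tau is over (0, tau] if [at_ruin], and over (0, tau) otherwise. *)
Definition payment_times (at_ruin : bool) (tau : \bar R) : set R :=
  [set t | 0 < t /\ (if at_ruin then t%:E <= tau else t%:E < tau)%E].

Definition discounted_dividends (at_ruin : bool) (delta : R) (tau : \bar R)
    (C : cumulative R R) : \bar R :=
  (\int[lebesgue_stieltjes_measure C]_(t in payment_times at_ruin tau)
     (expR (- (delta * t)))%:E)%E.

Definition J (at_ruin : bool) (delta a : R) (x : 'I_2 -> R) (u : control) :
    \bar R :=
  (\int[P]_w
     (a%:E * discounted_dividends at_ruin delta
               (ruin_time (reserve x u) w) (dividend u ord0 w)
      + (1 - a)%:E * discounted_dividends at_ruin delta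
               (ruin_time (reserve x u) w) (dividend u ord_max w)))%E.

End control_problem.

(* Main.v *)
Require Import Defs.
From HB Require Import structures.
From mathcomp Require Import all_boot all_order all_algebra.
From mathcomp Require Import all_classical all_reals all_analysis.
From mathcomp Require Import measurable_realfun.
From mathcomp Require Import ring lra.
Import Order.TTheory GRing.Theory Num.Theory.
Import numFieldNormedType.Exports.

Local Open Scope classical_set_scope.
Local Open Scope ring_scope.

(** The idea is to trade proportional reinsurance for a lower excess-of-loss
    retention that carries the same risk, and to distribute the drift that is
    saved. Fix a line and an instant, let theta be the proportional retention
    and s the excess level, i.e. the excess-of-loss retention divided by theta.
    Replace the pair by full proportional retention and the pure retention c
    such that sigma c = theta * sigma s. The stochastic integral is then
    unchanged, and the drift does not decrease. If the increase of drift is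
    paid out immediately as additional dividends, both controls lead to the
    same reserve, hence to the same ruin time, while the second one pays more.

    Drift comparison ([theta_mu_le]). By the layer cake formula, the mean and
    the second moment of the claim Y capped at s are mu s and sigma s ^+ 2
    ([mu_ofE], [sigma_ofE]). Thus U := theta * min(Y, s) and V := min(Y, c) have
    the same second moment, and mu c >= theta * mu s says E V >= E U. Now V is
    the point of ]-oo, Y] closest to c, and U lies in ]-oo, Y] because
    theta <= 1. Therefore E (c - V)^2 <= E (c - U)^2, and expanding the squares
    leaves 2 c (E U - E V) <= 0. Moving c to c + e covers the case c = 0.

    Choice of c ([risk_levelP]). The function sigma is continuous, since
    sigma (sqrt t) ^+ 2 is 1-Lipschitz in t, so every level strictly between 0
    and its supremum is attained. As theta < 1, the level theta * sigma s is
    either 0 or below the supremum, and the least c that reaches it is finite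
    and at most the maximal claim. This c is a monotone, hence Borel, function
    of the level, which makes the new retention progressive.

    The additional dividends are the running integral of the bounded
    progressive drift gain: they have Lipschitz nondecreasing paths, and are
    adapted by Tonelli's theorem. The equations of the two controlled reserves
    have exactly the same solutions, so that the reserves coincide. Finally the
    larger dividend process has the larger Stieltjes measure
    ([lebesgue_stieltjes_measure_le]), which compares the discounted dividends
    path by path. *)

Set Implicit Arguments.
Unset Strict Implicit.
Unset Printing Implicit Defensive.

(** * Measures, integrals and monotone functions *)

Section measures.
Context {R : realType}.

(** Both measures are infima, over the same covers by half-open intervals, of
    sums of increments. *)
Lemma lebesgue_stieltjes_measure_le (f g : cumulative R R) (A : set R) :
  (forall s t, s <= t -> f t - f s <= g t - g s) ->
  (lebesgue_stieltjes_measure f A <= lebesgue_stieltjes_measure g A)%E.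
Proof.
move=> fg; rewrite /lebesgue_stieltjes_measure /measure_extension /mu_ext.
apply: le_ereal_inf_tmp => _ [B cB <-].
apply: le_trans; first by apply: ereal_inf_lbound; exists B.
apply: lee_nneseries => [k _ _|k _]; first exact: wlength_ge0.
have [/(_ k) mB _] := cB.
have [->|[[a b] /= ab ->]] := (ocitvP (B k)).1 mB.
  by rewrite [leLHS](wlength0 f) [leRHS](wlength0 g).
by rewrite !wlength_itv_bnd ?lee_fin ?fg// ltW.
Qed.

(** The integral of a nonnegative function is the supremum of the integrals of
    the simple functions below it, so it is monotone for arbitrary functions.
    The payoff of a control is compared in this way, because its integrand
    depends on the outcome through the ruin time. *)
Lemma ge0_le_integral_pointwise {d} {T : measurableType d}
    (mu : {measure set T -> \bar R}) (f g : T -> \bar R) :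
  (forall w, 0 <= f w)%E -> (forall w, f w <= g w)%E ->
  (\int[mu]_w f w <= \int[mu]_w g w)%E.
Proof.
move=> f0 fg; have g0 w : (0 <= g w)%E by exact: le_trans (fg w).
rewrite !ge0_integralTE//; apply: ge_ereal_sup => _ [h hf <-].
by apply: ereal_sup_ubound; exists h => // w; exact: le_trans (fg w).
Qed.

(** The preimage of a half-line is upward closed, hence an interval with lower
    end its infimum. *)
Lemma nondecreasing_emeasurable (f : \bar R -> R) :
  {homo f : x y / (x <= y)%E >-> x <= y} -> measurable_fun setT f.
Proof.
move=> fnd; apply: (measurability (@RGenCInfty.G R)).
  exact: RGenCInfty.measurableE.
move=> _ [_ [r] -> <-]; rewrite setTI.
set U := _ @^-1` _; set i := ereal_inf U.
have Uup x y : U x -> (x <= y)%E -> U y.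
  by rewrite /U /= !in_itv/= !andbT => rx /fnd; exact: le_trans.
have ltU x : (i < x)%E -> U x.
  by move=> /ereal_inf_lt [y Uy /ltW]; exact: Uup.
have [Ui|Ui] := pselect (U i).
  rewrite (_ : U = [set` `[i, +oo[]); first exact: emeasurable_itv.
  apply/seteqP; split => x; rewrite /= in_itv/= andbT.
    exact: ereal_inf_lbound.
  exact: Uup.
rewrite (_ : U = [set` `]i, +oo[]); first exact: emeasurable_itv.
apply/seteqP; split => x; rewrite /= in_itv/= andbT; last exact: ltU.
move=> Ux; rewrite lt_neqAle ereal_inf_lbound// andbT.
by apply: contra_notN Ui => /eqP ->.
Qed.

Lemma nondecreasing_measurable_ereal (f : R -> \bar R) :
  {homo f : x y / x <= y >-> (x <= y)%E} -> measurable_fun setT f.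
Proof.
move=> fnd; apply: (measurability (@ErealGenCInfty.G R)).
  exact: ErealGenCInfty.measurableE.
move=> _ [_ [r] -> <-]; rewrite setTI.
apply: is_interval_measurable => s t /=.
rewrite !in_itv/= !andbT => fs _ u /andP[/fnd su _].
by rewrite in_itv/= andbT; exact: le_trans su.
Qed.

End measures.

(** * The layer cake formula for a claim *)

Section layer_cake.
Context {R : realType} {d : measure_display} {S : measurableType d}
  {Q : probability S R} (Y : {RV Q >-> R}).
Notation leb := (@lebesgue_measure R).

Lemma survivalE (y : R) : (survival Y y)%:E = ccdf Y y.
Proof.
rewrite ccdf_1_cdf /survival EFinB fineK//.
exact: (fin_num_measure (distribution Q Y)).
Qed.

Lemma survival_ge0 (y : R) : 0 <= survival Y y.
Proof. by rewrite -lee_fin survivalE measure_ge0. Qed.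

Lemma survival_nonincreasing (y z : R) : y <= z -> survival Y z <= survival Y y.
Proof.
by move=> yz; rewrite -lee_fin (survivalE y) (survivalE z) ccdf_nonincreasing.
Qed.

Lemma measurable_survival : measurable_fun setT (survival Y).
Proof.
apply/measurable_EFinP; apply: (eq_measurable_fun (ccdf Y)).
  by move=> y _; exact/esym/survivalE.
exact: ccdf_measurable.
Qed.

(** Write the survival function at y as the integral over outcomes of the
    indicator of y < Y and exchange the integrals. *)
Lemma layer_cake (g : R -> R) (D : set R) :
  measurable D -> measurable_fun setT g -> (forall y, D y -> 0 <= g y) ->
  (\int[leb]_(y in D) (g y * survival Y y)%:E =
   \int[Q]_w \int[leb]_(y in D `&` `]-oo, (Y w)[) (g y)%:E)%E.
Proof.
move=> mD mg g0.
pose A : set (measurableTypeR R * S) := [set yw | yw.1 < Y yw.2].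
pose f (yw : measurableTypeR R * S) : \bar R := ((g \_ D) yw.1 * \1_A yw)%:E.
have gD0 y : 0 <= (g \_ D) y.
  by rewrite patchE; case: ifPn => // /set_mem; exact: g0.
have mA : measurable A.
  have : measurable_fun setT (fun yw : measurableTypeR R * S => yw.1 < Y yw.2).
    by apply: measurable_fun_ltr => //; exact: measurableT_comp.
  by move=> /(_ measurableT [set true]); rewrite setTI; exact.
have mf : measurable_fun setT f.
  apply/measurable_EFinP; apply: measurable_funM; last exact: measurable_indic.
  apply: (measurableT_comp (f := g \_ D)) => //.
  by apply/(measurable_restrictT g mD); exact: measurable_funTS.
have f0 yw : (0 <= f yw)%E by rewrite lee_fin mulr_ge0.
transitivity (\int[leb]_y \int[Q]_w f (y, w))%E.
  rewrite integral_mkcond; apply: eq_integral => y _.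
  have mAy : measurable [set w | y < Y w].
    have : measurable_fun setT (fun w => y < Y w) by exact: measurable_fun_ltr.
    by move=> /(_ measurableT [set true]); rewrite setTI; exact.
  transitivity (\int[Q]_w (((g \_ D) y)%:E * (\1_[set w | y < Y w] w)%:E))%E.
    rewrite /= ge0_integralZl//; last 2 first.
    - exact/measurable_EFinP/measurable_indic.
    - by rewrite lee_fin.
    rewrite integral_indic// setIT !patchE.
    case: ifPn => _; last by rewrite mul0e.
    rewrite EFinM survivalE; congr (_ * Q _)%E.
    by apply/seteqP; split => w /=; rewrite in_itv/= andbT.
  by apply: eq_integral => w _; rewrite /f EFinM !indicE.
rewrite fubini_tonelli//; apply: eq_integral => w _.
rewrite integral_mkcondr integral_mkcond; apply: eq_integral => y _.
rewrite /f /= !patchE /A indicE /=.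
have -> : ((y, w) \in [set yw : R * S | yw.1 < Y yw.2]) = (y < Y w).
  by apply/idP/idP; [move/set_mem | move=> ?; apply/mem_set].
have -> : (y \in [set` `]-oo, (Y w)[]) = (y < Y w).
  by apply/idP/idP; [move/set_mem | move=> ?; apply/mem_set]; rewrite /= in_itv.
by case: (y \in D); case: (y < Y w); rewrite ?mulr1 ?mulr0 ?mul0r.
Qed.

End layer_cake.

(** * Capped claims *)

Section capped.
Context {R : realType}.
Notation leb := (@lebesgue_measure R).
Implicit Types (s : \bar R) (y z c : R).

(** The part of a claim that is kept under an excess-of-loss retention. *)
Definition capped s y : R := fine (Order.min y%:E s).

Lemma cappedy y : capped +oo%E y = y.
Proof. by rewrite /capped minEle leey. Qed.

Lemma capped_fin c y : capped c%:E y = Order.min y c.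
Proof. by rewrite /capped -EFin_min. Qed.

Lemma capped_ge0 s y : (0 <= s)%E -> 0 <= y -> 0 <= capped s y.
Proof. by move=> s0 y0; rewrite fine_ge0// le_min lee_fin y0. Qed.

Lemma capped_le s y : (0 <= s)%E -> 0 <= y -> capped s y <= y.
Proof.
case: s => [s||] // s0 y0; first by rewrite capped_fin ge_min lexx.
by rewrite cappedy.
Qed.

Lemma capped_homo s t y : (0 <= s)%E -> (s <= t)%E -> 0 <= y ->
  capped s y <= capped t y.
Proof.
case: s t => [s||] [t||]// s0 st y0; rewrite ?capped_fin ?cappedy//.
- by rewrite le_min !ge_min lexx /=; rewrite lee_fin in st; rewrite st orbT.
- by rewrite ge_min lexx.
Qed.

Lemma measurable_capped s : measurable_fun setT (capped s).
Proof.
apply: (measurableT_comp (f := fine)); first exact: fine_measurable.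
by apply: measurable_mine => //; exact: EFin_measurable.
Qed.

(** The domain of integration in the definitions of the premium and of the
    volatility. *)
Definition below s : set R := [set y | 0 <= y /\ (y%:E <= s)%E].

Lemma measurable_below s : measurable (below s).
Proof.
rewrite (_ : below s = `[0, +oo[ `&` (EFin @^-1` [set` `]-oo, s]])).
  apply: measurableI => //; rewrite -[X in measurable X]setTI.
  by apply: EFin_measurable => //; exact: emeasurable_itv.
by apply/seteqP; split => y /=; rewrite !in_itv/= ?andbT.
Qed.

(** The right end is open or closed according to whether the claim or the cap is
    the smaller one; this endpoint has measure 0. *)
Lemma belowIitv s z : (0 <= s)%E -> 0 <= z ->
  exists b, below s `&` `]-oo, z[ = [set` Interval (BLeft 0) (BSide b (capped s z))].
Proof.
move=> s0 z0; have [zs|sz] := leP z%:E s.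
- exists true; rewrite /capped minEle zs /=.
  apply/seteqP; split => y; rewrite /= !in_itv/=; first by case=> -[-> _] ->.
  by case/andP => y0 yz; split=> //; split => //; apply: le_trans zs; rewrite lee_fin ltW.
- case: s s0 sz => [s||]// s0; rewrite lte_fin => sz.
  exists false; rewrite capped_fin (min_idPr (ltW sz)).
  apply/seteqP; split => y; rewrite /= !in_itv/=.
    by case=> -[->]; rewrite lee_fin => ->.
  by case/andP => y0 ys; split; [split|exact: le_lt_trans sz].
Qed.

Lemma integral_below_cst1 s z : (0 <= s)%E -> 0 <= z ->
  (\int[leb]_(y in below s `&` `]-oo, z[) (cst 1 y)%:E = (capped s z)%:E)%E.
Proof.
move=> s0 z0; have [b ->] := belowIitv s0 z0.
rewrite /= integral_cst//= mul1e lebesgue_measure_itv/= lte_fin.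
have := capped_ge0 s0 z0; rewrite le_eqVlt => /predU1P[<-|->].
  by rewrite ltxx.
by rewrite sube0.
Qed.

Lemma integral_below_double s z : (0 <= s)%E -> 0 <= z ->
  (\int[leb]_(y in below s `&` `]-oo, z[) (2 * y)%:E = (capped s z ^+ 2)%:E)%E.
Proof.
move=> s0 z0; have [b ->] := belowIitv s0 z0.
have m2 (D : set R) : measurable_fun D (fun y => (2 * y)%:E).
  by apply/measurable_EFinP; exact: measurable_funM.
have := capped_ge0 s0 z0; set m := capped s z.
rewrite le_eqVlt => /predU1P[<-|m0].
  rewrite expr0n/=; case: b; first by rewrite set_itvco0 integral_set0.
  by rewrite set_itv1 integral_set1.
transitivity (\int[leb]_(y in `[0%R, m]) (2 * y)%:E)%E.
  by case: b => //; rewrite integral_itv_bndo_bndc.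
rewrite (@continuous_FTC2 _ _ (fun y => y ^+ 2))//.
- by rewrite expr0n/= sube0.
- apply: continuous_subspaceT => y; apply: cvgMl_tmp; exact: cvg_id.
- split.
  + by move=> y _; exact: exprn_derivable.
  + apply: cvg_at_right_filter; exact: exprn_continuous.
  + apply: cvg_at_left_filter; exact: exprn_continuous.
- by move=> y _; rewrite exp_derive1 expr1.
Qed.

End capped.

(** * Premium and risk as moments of capped claims *)

Section premium_and_risk.
Context {R : realType} {d : measure_display} {S : measurableType d}
  {Q : probability S R} (Y : {RV Q >-> R}).
Hypothesis Y_ge0 : forall w, 0 <= Y w.
Hypothesis Y_moment1 : Q.-integrable setT (fun w => (Y w)%:E).
Hypothesis Y_moment2 : Q.-integrable setT (fun w => (Y w ^+ 2)%:E).
Notation leb := (@lebesgue_measure R).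
Notation mu := (mu_of (survival Y)).
Notation sigma := (sigma_of (survival Y)).

Let cap s w := capped s (Y w).

Lemma measurable_capped_claim s : measurable_fun setT (cap s).
Proof. exact: (measurableT_comp (measurable_capped s)). Qed.

Lemma integrable_capped_claim s : (0 <= s)%E ->
  Q.-integrable setT (EFin \o cap s).
Proof.
move=> s0; apply: le_integrable Y_moment1 => //.
  exact/measurable_EFinP/measurable_capped_claim.
move=> w _ /=; rewrite !lee_fin !ger0_norm//; first exact: capped_le.
exact: capped_ge0.
Qed.

Lemma integrable_capped_claim2 s : (0 <= s)%E ->
  Q.-integrable setT (EFin \o (fun w => cap s w ^+ 2)).
Proof.
move=> s0; apply: le_integrable Y_moment2 => //.
  exact/measurable_EFinP/measurable_funX/measurable_capped_claim.
move=> w _ /=; rewrite !lee_fin !ger0_norm ?sqr_ge0//.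
by rewrite lerXn2r ?nnegrE ?capped_ge0 ?capped_le.
Qed.

Lemma mu_ofE s : (0 <= s)%E -> mu s = \int[Q]_w cap s w.
Proof.
move=> s0; rewrite /mu_of /Rintegral; congr fine.
transitivity (\int[leb]_(y in below s) (cst 1 y * survival Y y)%:E)%E.
  by apply: eq_integral => y _; rewrite mul1r.
rewrite layer_cake//; last exact: measurable_below.
by apply: eq_integral => w _; exact: integral_below_cst1.
Qed.

Lemma sigma_ofE s : (0 <= s)%E -> sigma s = Num.sqrt (\int[Q]_w (cap s w ^+ 2)).
Proof.
move=> s0; rewrite /sigma_of /Rintegral; congr (Num.sqrt (fine _)).
rewrite layer_cake//; last 2 first.
- exact: measurable_below.
- by move=> y [y0 _]; rewrite mulr_ge0.
by apply: eq_integral => w _; exact: integral_below_double.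
Qed.

Lemma sqr_sigma_of s : (0 <= s)%E -> sigma s ^+ 2 = \int[Q]_w (cap s w ^+ 2).
Proof.
move=> s0; rewrite sigma_ofE// sqr_sqrtr//.
by apply: Rintegral_ge0 => w _; exact: sqr_ge0.
Qed.

Lemma below_lt0 (s : \bar R) : (s < 0)%E -> below s = set0.
Proof.
move=> s0; apply/seteqP; split => // y [y0 ys].
by have := le_lt_trans ys s0; rewrite lte_fin ltNge y0.
Qed.

Lemma mu_of_lt0 s : (s < 0)%E -> mu s = 0.
Proof.
move=> s0; rewrite /mu_of (_ : [set y | _] = set0) ?Rintegral_set0//.
exact: below_lt0.
Qed.

Lemma sigma_of_lt0 s : (s < 0)%E -> sigma s = 0.
Proof.
move=> s0; rewrite /sigma_of (_ : [set y | _] = set0) ?Rintegral_set0 ?sqrtr0//.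
exact: below_lt0.
Qed.

Lemma mu_of_ge0 s : 0 <= mu s.
Proof.
have [s0|/mu_of_lt0 ->//] := leP 0%E s.
by rewrite mu_ofE//; apply: Rintegral_ge0 => w _; exact: capped_ge0.
Qed.

Lemma sigma_of_ge0 s : 0 <= sigma s. Proof. exact: sqrtr_ge0. Qed.

Lemma mu_of_nondecreasing : {homo mu : s t / (s <= t)%E >-> s <= t}.
Proof.
move=> s t st; have [s0|/mu_of_lt0 ->] := leP 0%E s; last exact: mu_of_ge0.
have t0 := le_trans s0 st; rewrite !mu_ofE//.
apply: le_Rintegral; [by []|exact: integrable_capped_claim..|].
by move=> w _; exact: capped_homo.
Qed.

Lemma sigma_of_nondecreasing : {homo sigma : s t / (s <= t)%E >-> s <= t}.
Proof.
move=> s t st; have [s0|/sigma_of_lt0 ->] := leP 0%E s; last exact: sigma_of_ge0.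
have t0 := le_trans s0 st; rewrite !sigma_ofE//; apply: ler_wsqrtr.
apply: le_Rintegral; [by []|exact: integrable_capped_claim2..|].
by move=> w _; rewrite lerXn2r ?nnegrE ?capped_ge0 ?capped_homo.
Qed.

Lemma Rintegral_cst_prob (r : R) : \int[Q]_w cst r w = r.
Proof.
rewrite Rintegral_cst// -[RHS]mulr1; congr (_ * _).
exact: (congr1 fine (probability_setT Q)).
Qed.

Lemma sigma_of0 : sigma 0%E = 0.
Proof.
rewrite sigma_ofE// (@eq_Rintegral _ _ _ _ _ (cst 0)) ?Rintegral_cst_prob ?sqrtr0//.
by move=> w _; rewrite /cap capped_fin (min_idPr (Y_ge0 w)) expr0n.
Qed.

(** Raising the cap from b to c raises the square of a capped claim by at most
    c ^+ 2 - b ^+ 2. This is the modulus of continuity of the volatility. *)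
Lemma sqr_sigma_of_le b c : 0 <= b -> b <= c ->
  sigma c%:E ^+ 2 - sigma b%:E ^+ 2 <= c ^+ 2 - b ^+ 2.
Proof.
move=> b0 bc; have c0 := le_trans b0 bc.
rewrite !sqr_sigma_of ?lee_fin// -RintegralB//; [|exact: integrable_capped_claim2..].
have -> : c ^+ 2 - b ^+ 2 = \int[Q]_w (cst (c ^+ 2 - b ^+ 2) w).
  by rewrite Rintegral_cst_prob.
apply: le_Rintegral => //.
- exact: (integrableB measurableT (integrable_capped_claim2 (s := c%:E) _)
    (integrable_capped_claim2 (s := b%:E) _)).
- exact: finite_measure_integrable_cst.
- move=> w _; rewrite /cap !capped_fin /=.
  have y0 := Y_ge0 w; rewrite /Order.min; case: ifPn => yc; case: ifPn => yb; nra.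
Qed.

(** At equal volatility, a pure excess-of-loss treaty keeps at least as much
    drift as one combined with proportional reinsurance: among the positions
    that never exceed the claim, the claim capped at c is the closest one to
    c in mean square, and at a fixed second moment being closer to c means
    having a larger mean. *)
Lemma theta_mu_le (theta : R) s c : 0 < theta <= 1 -> (0 <= s)%E -> 0 <= c ->
  sigma c%:E = theta * sigma s -> theta * mu s <= mu c%:E.
Proof.
move=> /andP[t0 t1] s0 c0 eqs; have c0' : (0 <= c%:E)%E by rewrite lee_fin.
have {}eqs : \int[Q]_w (cap c%:E w ^+ 2) = theta ^+ 2 * \int[Q]_w (cap s w ^+ 2).
  by rewrite -!sqr_sigma_of// -exprMn eqs.
rewrite !mu_ofE//; set A := \int[Q]_w cap s w; set B := \int[Q]_w cap c%:E w.
have lin f g a b : Q.-integrable setT (EFin \o f) -> Q.-integrable setT (EFin \o g) ->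
    Q.-integrable setT (EFin \o (fun w => a * f w + b * g w)) /\
    \int[Q]_w (a * f w + b * g w) = a * \int[Q]_w f w + b * \int[Q]_w g w.
  move=> fi gi.
  have fi' : Q.-integrable setT (EFin \o (fun w => a * f w)).
    by exact: (integrableZl measurableT a fi).
  have gi' : Q.-integrable setT (EFin \o (fun w => b * g w)).
    by exact: (integrableZl measurableT b gi).
  split; last by rewrite RintegralD// !RintegralZl.
  exact: (integrableD measurableT fi' gi').
(* The centre k > c leaves an error e ^+ 2, harmless after division by
   2 * k >= 2 * e; with k = c nothing could be divided out when c = 0. *)
apply/ler_addgt0Pr => e e0; pose k := c + e.
have k0 : 0 < 2 * k by rewrite /k; lra.
have [i1 e1] := lin _ _ (2 * k * theta) (- theta ^+ 2)
  (integrable_capped_claim s0) (integrable_capped_claim2 s0).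
have [i2 e2] := lin _ _ (2 * k) (-1)
  (integrable_capped_claim c0') (integrable_capped_claim2 c0').
have i3 : Q.-integrable setT (EFin \o cst 1) by exact: finite_measure_integrable_cst.
have [i4 e4] := lin _ _ 1 (e ^+ 2) i2 i3.
have : \int[Q]_w (2 * k * theta * cap s w + - theta ^+ 2 * cap s w ^+ 2) <=
       \int[Q]_w (1 * (2 * k * cap c%:E w + -1 * cap c%:E w ^+ 2) + e ^+ 2 * cst 1 w).
  apply: le_Rintegral => // w _; rewrite /cap capped_fin /=.
  have y0 := Y_ge0 w; have ys := capped_le s0 y0; have s1 := capped_ge0 s0 y0.
  set u := capped s (Y w) in ys s1 *; set y := Y w in y0 ys *.
  have uy : theta * u <= y by nra.
  (* If y < c, the capped claim is y, and theta * u <= y <= k. Otherwise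
     it is c, at distance e from k. *)
  suff : (k - Order.min y c) ^+ 2 <= (k - theta * u) ^+ 2 + e ^+ 2 by nra.
  have [yc|_] := ltP y c; last by rewrite /k addrAC subrr add0r lerDr sqr_ge0.
  suff : (k - y) ^+ 2 <= (k - theta * u) ^+ 2 by move=> /le_trans; apply; nra.
  by rewrite lerXn2r ?nnegrE /k; lra.
rewrite e4 e2 e1 Rintegral_cst_prob eqs -/A -/B.
move=> h; have {}h : 2 * k * (theta * A) <= 2 * k * B + e ^+ 2 by lra.
have : 2 * k * (theta * A) <= 2 * k * (B + e) by rewrite /k in h *; nra.
by rewrite ler_pM2l.
Qed.

End premium_and_risk.

(** * The retention that carries a given risk *)

Section risk_level.
Context {R : realType} {d : measure_display} {S : measurableType d}
  {Q : probability S R} (Y : {RV Q >-> R}).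
Hypothesis Y_ge0 : forall w, 0 <= Y w.
Hypothesis Y_moment2 : Q.-integrable setT (fun w => (Y w ^+ 2)%:E).
Notation leb := (@lebesgue_measure R).
Notation sigma := (sigma_of (survival Y)).

(** In the variable t = c ^+ 2 the modulus of continuity [sqr_sigma_of_le]
    becomes a Lipschitz constant 1. *)
Lemma continuous_sqr_sigma_of_sqrt :
  continuous (fun t : R => sigma (Num.sqrt t)%:E ^+ 2).
Proof.
set psi := fun t : R => _.
have psi_le s t : s <= t -> 0 <= psi t - psi s <= t - s.
  move=> st; have sst : Num.sqrt s <= Num.sqrt t by exact: ler_wsqrtr.
  apply/andP; split.
    rewrite subr_ge0 lerXn2r ?nnegrE ?sigma_of_ge0//.
    exact: (sigma_of_nondecreasing Y_ge0 Y_moment2).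
  apply: le_trans (sqr_sigma_of_le Y_ge0 Y_moment2 (sqrtr_ge0 _) sst) _.
  have [s0|s0] := leP 0 s; first by rewrite !sqr_sqrtr// (le_trans s0).
  rewrite (ler0_sqrtr (ltW s0)) expr0n/= subr0.
  have [t0|t0] := leP 0 t; first by rewrite sqr_sqrtr//; lra.
  by rewrite (ler0_sqrtr (ltW t0)) expr0n/= subr_ge0.
have psi_dist s t : `|psi s - psi t| <= `|s - t|.
  wlog st : s t / s <= t.
    by move=> h; have [/h//|/ltW/h] := leP s t; rewrite distrC [leRHS]distrC.
  have /andP[p0 p1] := psi_le s t st.
  by rewrite distrC [leRHS]distrC !ger0_norm// subr_ge0.
move=> t; apply/cvgrPdist_le => e e0; near=> s.
apply: le_trans (psi_dist _ _) _; near: s.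
by apply: (@cvgr_dist_le _ _ _ (nbhs t) _ id t) => //; exact: cvg_id.
Unshelve. all: by end_near.
Qed.

Lemma sigma_of_ivt (b c v : R) : 0 <= b -> b <= c ->
  sigma b%:E <= v <= sigma c%:E ->
  exists2 x, b <= x <= c & sigma x%:E = v.
Proof.
move=> b0 bc /andP[bv vc]; have c0 := le_trans b0 bc.
have v0 : 0 <= v := le_trans (sigma_of_ge0 _ _) bv.
have bc2 : b ^+ 2 <= c ^+ 2 by rewrite lerXn2r.
have cont : {within `[b ^+ 2, c ^+ 2],
    continuous (fun t : R => sigma (Num.sqrt t)%:E ^+ 2)}.
  exact/continuous_subspaceT/continuous_sqr_sigma_of_sqrt.
have [|x + xv] := @IVT _ _ _ _ (v ^+ 2) bc2 cont.
  rewrite !sqrtr_sqr !ger0_norm//.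
  apply/andP; split; first by rewrite ge_min lerXn2r ?nnegrE ?sigma_of_ge0.
  by rewrite le_max orbC lerXn2r ?nnegrE ?sigma_of_ge0.
rewrite in_itv/= => /andP[bx xc]; exists (Num.sqrt x).
  by rewrite -[b]ger0_norm// -[c]ger0_norm// -!sqrtr_sqr !ler_wsqrtr.
have /eqP := xv; rewrite eqrXn2 ?sigma_of_ge0//; exact/eqP.
Qed.

(** Monotone convergence along the integer caps. *)
Lemma sigma_of_cofinal (v : R) : v < sigma +oo%E ->
  exists2 b, 0 <= b & v <= sigma b%:E.
Proof.
move=> vy; have [v0|v0] := ltP v 0.
  by exists 0 => //; rewrite (le_trans (ltW v0))// sigma_of_ge0.
have intE s : (0 <= s)%E ->
    (\int[leb]_(y in below s) (2 * y * survival Y y)%:E)%E = (sigma s ^+ 2)%:E.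
  move=> s0; rewrite (sqr_sigma_of Y_ge0)// /Rintegral fineK.
    rewrite layer_cake//; last 2 first.
    - exact: measurable_below.
    - by move=> y [y0 _]; rewrite mulr_ge0.
    by apply: eq_integral => w _; exact: integral_below_double.
  by apply: integrable_fin_num => //; exact: (integrable_capped_claim2 Y_ge0).
pose F n : set R := below n%:R%:E.
have FU : \bigcup_n F n = below +oo%E.
  apply/seteqP; split => y.
    by move=> [n _ [y0 _]]; split => //; exact: leey.
  move=> [y0 _]; exists (Num.truncn y).+1 => //; split => //.
  by rewrite lee_fin ltW// truncnS_gt.
have cvgF : (\int[leb]_(y in F n) (2 * y * survival Y y)%:E)%E @[n --> \oo] -->
    (\int[leb]_(y in \bigcup_n F n) (2 * y * survival Y y)%:E)%E.
  apply: ge0_nondecreasing_set_cvg_integral.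
  - move=> m n mn; apply/subsetPset => y [y0 ym]; split => //.
    by apply: le_trans ym _; rewrite lee_fin ler_nat.
  - by move=> n; exact: measurable_below.
  - move=> n; apply/measurable_EFinP; apply: measurable_funM.
      exact: measurable_funM.
    exact: measurable_funTS (measurable_survival Y).
  - by move=> n y [y0 _]; rewrite lee_fin !mulr_ge0// survival_ge0.
rewrite FU intE// in cvgF.
have [n vn] : exists n : nat, ((v ^+ 2)%:E <
     \int[leb]_(y in F n) (2 * y * survival Y y)%:E)%E.
  apply: contrapT => /forallNP h; move: vy; apply/negP; rewrite -leNgt.
  have : ((sigma +oo ^+ 2)%:E <= (v ^+ 2)%:E)%E.
    apply: (cvge_to_le cvgF); apply: nearW => n /=.
    by rewrite leNgt; apply/negP; exact: h.
  by rewrite lee_fin ler_pXn2r ?nnegrE ?sigma_of_ge0.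
exists n%:R => //; rewrite intE ?lee_fin// lte_fin in vn.
by have := ltW vn; rewrite ler_pXn2r ?nnegrE ?sigma_of_ge0.
Qed.

Lemma sigma_of_survival_eq0 (y : R) : 0 <= y -> survival Y y = 0 ->
  sigma y%:E = sigma +oo%E.
Proof.
move=> y0 Sy; rewrite /sigma_of; congr (Num.sqrt _).
rewrite Rintegral_mkcond [RHS]Rintegral_mkcond; apply: eq_Rintegral => z _.
rewrite !patchE; have [zy|yz] := leP z y.
  congr (if _ then _ else _); apply/idP/idP => /set_mem [z0 _]; apply/mem_set; split => //.
  exact: leey.
have -> : survival Y z = 0.
  by apply/eqP; rewrite eq_le survival_ge0 andbT -Sy survival_nonincreasing// ltW.
by rewrite mulr0 !if_same.
Qed.

(** A generalised inverse of the volatility. Taking the infimum in the extended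
    reals makes it monotone on the whole line, hence measurable: beyond the
    supremum of the volatility its value is +oo. *)
Definition risk_level (v : R) : \bar R :=
  ereal_inf [set c%:E | c in [set c | 0 <= c /\ v <= sigma c%:E]].

Lemma risk_level_nondecreasing : {homo risk_level : v w / v <= w >-> (v <= w)%E}.
Proof.
move=> v w vw; apply: le_ereal_inf_tmp => _ [c [c0 wc] <-].
by apply: ereal_inf_lbound; exists c => //; split => //; exact: le_trans wc.
Qed.

(** The two cases are the values that theta * sigma s can take when theta < 1:
    below the supremum the level is reached at a finite retention, and at 0 it
    is reached by retaining nothing. A retention where the survival function
    vanishes already has the maximal volatility, so the least solution cannot
    exceed any of them. *)
Lemma risk_levelP (v : R) : 0 <= v -> v = 0 \/ v < sigma +oo%E ->
  exists c, [/\ 0 <= c, sigma c%:E = v, risk_level v = c%:E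
    & (risk_level v <= claim_max (survival Y))%E].
Proof.
move=> v0 hv.
have [b b0 vb] : exists2 b, 0 <= b & v <= sigma b%:E.
  by case: hv => [->|/sigma_of_cofinal//]; exists 0; rewrite ?sigma_of_ge0.
have lev0 : (0 <= risk_level v)%E.
  by apply: le_ereal_inf_tmp => _ [c [c0 _] <-]; rewrite lee_fin.
have levb : (risk_level v <= b%:E)%E by apply: ereal_inf_lbound; exists b.
have [c lev] : exists c, risk_level v = c%:E.
  exists (fine (risk_level v)); rewrite fineK// ge0_fin_numE//.
  exact: le_lt_trans levb (ltry b).
rewrite lev !lee_fin in lev0 levb.
exists c; split => //; last first.
  apply: le_ereal_inf_tmp => _ [y [y0 Sy] <-]; apply: ereal_inf_lbound.
  exists y => //; split => //; rewrite sigma_of_survival_eq0//.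
  by case: hv => [->|/ltW//]; exact: sigma_of_ge0.
apply/eqP; rewrite eq_le; apply/andP; split.
  have [b' b'P b'v] : exists2 b', 0 <= b' <= b & sigma b'%:E = v.
    by apply: sigma_of_ivt => //; rewrite (sigma_of0 Y_ge0) v0 vb.
  rewrite -b'v; apply: (sigma_of_nondecreasing Y_ge0 Y_moment2); rewrite -lev.
  have /andP[b'0 _] := b'P; apply: ereal_inf_lbound.
  by exists b' => //; split => //; rewrite b'v.
(* If the level were not reached at the infimum c, a retention c' > c reaching
   an intermediate level would bound from below all those that reach v. *)
rewrite leNgt; apply/negP => cv; pose v' := (sigma c%:E + v) / 2.
have [c' /andP[cc' _] c'v'] : exists2 c', c <= c' <= b & sigma c'%:E = v'.
  by apply: sigma_of_ivt => //; rewrite /v'; lra.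
have : (c'%:E <= c%:E)%E.
  rewrite -lev; apply: le_ereal_inf_tmp => _ [y [y0 vy] <-].
  rewrite lee_fin leNgt; apply/negP => /ltW yc'.
  have : sigma y%:E <= sigma c'%:E.
    by apply: (sigma_of_nondecreasing Y_ge0 Y_moment2); rewrite lee_fin.
  by rewrite c'v' /v'; lra.
by move=> /(sigma_of_nondecreasing Y_ge0 Y_moment2); rewrite c'v' /v'; lra.
Qed.

End risk_level.

(** * Progressive processes and their running integrals *)

Section filtered_space.
Context {R : realType} {d : measure_display} {T : measurableType d}.
Variable F : R -> set (set T).
Hypothesis Fsigma : forall t, 0 <= t -> sigma_algebra setT (F t).
Notation leb := (@lebesgue_measure R).
Local Notation info t := (g_sigma_algebraType (F t)).

(** A process restricted to this set, with the information at time t on the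
    space of outcomes, is measurable for all t exactly when it is progressive.
    Theorems on measurable functions of a product space then apply. *)
Definition strip (t : R) : set (measurableTypeR R * info t) :=
  [set sw | 0 <= sw.1 <= t].
Arguments strip : clear implicits.

Lemma measurable_strip t : measurable (strip t).
Proof.
rewrite (_ : strip t = `[0, t] `*` setT); last first.
  by apply/seteqP; split => sw; rewrite /strip /= in_itv/=; [move=> -> | case].
by apply: measurableX => //; exact: measurable_itv.
Qed.

Arguments measurable_strip : clear implicits.

Lemma sub_measurableP {d'} {E : measurableType d'} (t : R) (X : T -> E) : 0 <= t ->
  sub_measurable (F t) X <-> measurable_fun setT (X : info t -> E).
Proof.
move=> t0; have FE := measurable_g_measurableTypeE (Fsigma t0).
split => [mX _ B mB|mX B mB].
  by rewrite setTI FE; exact: mX.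
by have := mX measurableT B mB; rewrite setTI FE.
Qed.

Lemma progressiveP {d'} {E : measurableType d'} (X : R -> T -> E) :
  progressive F X <-> forall t, 0 <= t ->
    measurable_fun (strip t) (fun sw : measurableTypeR R * info t => X sw.1 sw.2).
Proof.
have E1 t : 0 <= t ->
    <<s [set A `*` G | A in (@measurable _ (measurableTypeR R)) & G in F t] >>
    = @measurable _ (measurableTypeR R * info t)%type.
  move=> t0; rewrite measurable_prod_measurableType.
  by rewrite (measurable_g_measurableTypeE (Fsigma t0)).
split => [pX t t0 _ B mB|mX t t0 B mB].
  by have := pX t t0 B mB; rewrite E1.
by rewrite E1//; exact: mX t t0 (measurable_strip t) B mB.
Qed.

Section running_integral.
Variables (phi : R -> T -> R) (K : R).
Hypothesis phi_prog : progressive F phi.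
Hypothesis phi_bnd : forall s w, 0 <= s -> 0 <= phi s w <= K.

Definition running_integral (w : T) (t : R) : R := \int[leb]_(s in `[0, t]) phi s w.

Lemma measurable_path (w : T) (t : R) : 0 <= t -> measurable_fun `[0, t] (phi^~ w).
Proof.
move=> t0; have mphi := (progressiveP phi).1 phi_prog t t0.
apply: (measurable_comp (F := strip t)
  (f := fun sw : measurableTypeR R * info t => phi sw.1 sw.2)
  (g := fun s => (s, w)) _ _ mphi).
- exact: measurable_strip.
- by move=> _ [s /= + <-]; rewrite /strip in_itv.
- by apply: measurable_funTS; exact: pair2_measurable.
Qed.

Lemma itv_ge0_bounded (w : T) (t : R) : forall s, s \in `[0, t] -> 0 <= phi s w <= K.
Proof. by move=> s; rewrite in_itv/= => /andP[s0 _]; exact: phi_bnd. Qed.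

Lemma integrable_path (w : T) (t : R) : leb.-integrable `[0, t] (EFin \o phi^~ w).
Proof.
have [t0|t0] := leP 0 t; last first.
  by rewrite set_itv_ge ?bnd_simp -?ltNge//; exact: integrable_set0.
apply: measurable_bounded_integrable => //.
- by rewrite /= lebesgue_measure_itv/=; case: ifP => _; rewrite ?ltry// -EFinB ltry.
- exact: measurable_path.
- exists K; split; rewrite ?num_real // => M /ltW KM s /=.
  move=> /(itv_ge0_bounded w) /andP[p0 pK].
  by rewrite ger0_norm// (le_trans pK).
Qed.

Lemma running_integral_lt0 (w : T) (t : R) : t < 0 -> running_integral w t = 0.
Proof.
by move=> t0; rewrite /running_integral set_itv_ge ?bnd_simp -?ltNge// Rintegral_set0.
Qed.

(** The integral over `[0, t] is empty for t < 0, so the path is constant there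
    and is nondecreasing and Lipschitz on the whole line. *)
Lemma running_integral_increment (w : T) (s t : R) : s <= t ->
  0 <= running_integral w t - running_integral w s <= K * (t - s).
Proof.
have K0 : 0 <= K by have /andP[+ ?] := phi_bnd w (lexx 0); move=> /le_trans; apply.
move=> st; have [t0|t0] := ltP t 0.
  by rewrite !running_integral_lt0// ?(le_lt_trans st)// subrr lexx mulr_ge0// subr_ge0.
have incr r : 0 <= r -> r <= t -> 0 <= \int[leb]_(q in `]r, t]) phi q w <= K * (t - r).
  move=> r0 rt; have ph q : q \in `]r, t] -> 0 <= phi q w <= K.
    by rewrite in_itv/= => /andP[rq _]; apply: phi_bnd; exact: le_trans (ltW rq).
  have ip : leb.-integrable `]r, t] (EFin \o phi^~ w).
    apply: integrableS (integrable_path w t) => //.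
    by apply: subset_itv; rewrite bnd_simp.
  rewrite Rintegral_ge0/=; last by move=> q /ph /andP[].
  have -> : K * (t - r) = \int[leb]_(q in `]r, t]) cst K q.
    rewrite Rintegral_cst//= lebesgue_measure_itv/= lte_fin.
    by move: rt; rewrite le_eqVlt => /predU1P[->|->//]; rewrite ltxx subrr.
  apply: le_Rintegral => //.
    apply: measurable_bounded_integrable => //; last exact: bounded_cst.
    by rewrite /= lebesgue_measure_itv/=; case: ifP => _; rewrite ?ltry// -EFinB ltry.
  by move=> q /ph /andP[].
have sub r : 0 <= r -> r <= t -> running_integral w t - running_integral w r =
    \int[leb]_(q in `]r, t]) phi q w.
  move=> r0 rt; apply: Rintegral_itvB; first exact: integrable_path.
  - by rewrite bnd_simp.
  - by rewrite bnd_simp.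
have [s0|s0] := leP 0 s; first by rewrite sub//; exact: incr.
have A0 : running_integral w 0 = 0.
  by rewrite /running_integral set_itv1 Rintegral_set1.
have /andP[] := incr 0 (lexx 0) t0; rewrite -sub// A0 !subr0 => p0 p1.
rewrite (running_integral_lt0 w s0) subr0 p0 (le_trans p1)//.
by rewrite ler_wpM2l//; lra.
Qed.

Lemma running_integral_nondecreasing w : nondecreasing (running_integral w).
Proof.
move=> s t st; rewrite -subr_ge0.
by have /andP[] := running_integral_increment w st.
Qed.

Lemma running_integral_right_continuous w : right_continuous (running_integral w).
Proof.
apply: right_continuousW => t; apply/cvgrPdist_le => e e0.
have [k k0 Kk] : exists2 k, 0 < k & K <= k.
  by exists (`|K| + 1); have := ler_norm K; have := normr_ge0 K; lra.
have dist s : `|running_integral w t - running_integral w s| <= k * `|t - s|.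
  have [st|/ltW st] := leP s t; have /andP[p0 p1] := running_integral_increment w st.
  - rewrite (ger0_norm p0) ger0_norm ?subr_ge0//; apply: le_trans p1 _.
    by rewrite ler_wpM2r ?subr_ge0.
  - rewrite distrC [in leRHS]distrC (ger0_norm p0) ger0_norm ?subr_ge0//.
    by apply: le_trans p1 _; rewrite ler_wpM2r ?subr_ge0.
near=> s; apply: le_trans (dist s) _; rewrite -ler_pdivlMl//; near: s.
apply: (@cvgr_dist_le _ _ _ (nbhs t) _ id t); first exact: cvg_id.
by rewrite mulr_gt0// invr_gt0.
Unshelve. all: by end_near.
Qed.

(** Tonelli's theorem, on the product of the line with the outcomes carrying
    the information at time t. *)
Lemma adapted_running_integral (t : R) : 0 <= t ->
  sub_measurable (F t) (running_integral^~ t).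
Proof.
move=> t0; apply/sub_measurableP => //.
have mphi := (progressiveP phi).1 phi_prog t t0.
pose f : measurableTypeR R * info t -> \bar R :=
  (fun sw => (phi sw.1 sw.2)%:E) \_ (strip t).
have mf : measurable_fun setT f.
  apply/(measurable_restrictT _ (measurable_strip t)).
  exact/measurable_EFinP.
have f0 sw : (0 <= f sw)%E.
  rewrite /f patchE; case: ifPn => // /set_mem /andP[s0 _].
  by rewrite lee_fin; have /andP[] := phi_bnd sw.2 s0.
have := measurable_fun_fubini_tonelli_G (m1 := leb) f mf f0.
move=> /(measurableT_comp (fine_measurable measurableT)).
apply: eq_measurable_fun => w _.
rewrite /running_integral /Rintegral /fubini_G /=; congr fine.
rewrite [RHS]integral_mkcond; apply: eq_integral => s _.
rewrite /f !patchE /=; congr (if _ then _ else _).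
Qed.

End running_integral.
End filtered_space.

Lemma cumulative_exists {R : realType} (f : R -> R) :
  nondecreasing f -> right_continuous f -> exists g : cumulative R R, g =1 f.
Proof.
move=> nd rc; pose m := isCumulative.Build R _ R f nd rc.
by exists (HB.pack_for (cumulative R R) f m).
Qed.

Section progressive_operations.
Context {R : realType} {d : measure_display} {T : measurableType d}.
Variable F : R -> set (set T).
Hypothesis Fsigma : forall t, 0 <= t -> sigma_algebra setT (F t).

Lemma progressive_comp {d1 d2} {E1 : measurableType d1} {E2 : measurableType d2}
    (h : E1 -> E2) (X : R -> T -> E1) :
  measurable_fun setT h -> progressive F X ->
  progressive F (fun t w => h (X t w)).
Proof.
move=> mh /(progressiveP Fsigma) pX; apply/(progressiveP Fsigma) => t t0.
exact: measurableT_comp (pX t t0).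
Qed.

Lemma progressiveM (X Y : R -> T -> R) : progressive F X -> progressive F Y ->
  progressive F (fun t w => X t w * Y t w).
Proof.
move=> /(progressiveP Fsigma) pX /(progressiveP Fsigma) pY.
by apply/(progressiveP Fsigma) => t t0; exact: measurable_funM (pX t t0) (pY t t0).
Qed.

Lemma progressiveB (X Y : R -> T -> R) : progressive F X -> progressive F Y ->
  progressive F (fun t w => X t w - Y t w).
Proof.
move=> /(progressiveP Fsigma) pX /(progressiveP Fsigma) pY.
by apply/(progressiveP Fsigma) => t t0; exact: measurable_funB (pX t t0) (pY t t0).
Qed.

Lemma progressive_cst {d'} {E : measurableType d'} (c : E) :
  progressive F (fun _ _ => c).
Proof. by apply/(progressiveP Fsigma) => t t0; exact: measurable_cst. Qed.

(** On the positive half-line the inverse is the power of exponent -1, which is a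
    Borel function on the whole line. *)
Lemma progressive_ediv (X : R -> T -> \bar R) (Y : R -> T -> R) :
  (forall t w, 0 <= t -> 0 < Y t w) -> progressive F X -> progressive F Y ->
  progressive F (fun t w => (X t w * ((Y t w)^-1)%:E)%E).
Proof.
move=> Y0 /(progressiveP Fsigma) pX /(progressiveP Fsigma) pY.
apply/(progressiveP Fsigma) => t t0; apply: emeasurable_funM (pX t t0) _.
apply/measurable_EFinP.
have := measurableT_comp (@measurable_powR R (-1)) (pY t t0).
apply: eq_measurable_fun => sw /set_mem /andP[s0 _] /=.
by rewrite powR_inv1// ltW// Y0.
Qed.

Lemma adaptedD (X Y : R -> T -> R) : adapted F X -> adapted F Y ->
  adapted F (fun t w => X t w + Y t w).
Proof.
move=> aX aY t t0; apply/(sub_measurableP Fsigma) => //.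
by apply: measurable_funD; apply/(sub_measurableP Fsigma) => //; [exact: aX|exact: aY].
Qed.

End progressive_operations.

(** An Ito integral depends on its integrand only through integrals over
    intervals [0, t]. *)
Lemma ito_integral_eq {R : realType} {d : measure_display} {T : measurableType d}
    (P : probability T R) (F : R -> set (set T)) (W H H' Z : R -> T -> R) :
  (forall s w, 0 <= s -> H s w = H' s w) ->
  ito_integral P F W H Z -> ito_integral P F W H' Z.
Proof.
move=> HH [aZ cZ sZ]; split; [exact: aZ|exact: cZ|].
move=> t t0; have [S [S1 S2 S3]] := sZ t t0.
exists S; split; [exact: S1| |exact: S3]; move: S2.
set a := fun n => _; set b := fun n => _; suff -> : a = b by exact.
apply/funext => n; apply: eq_integral => w _; apply: eq_integral => s.
by rewrite inE/= in_itv/= => /andP[s0 _]; rewrite HH.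
Qed.

Lemma discounted_dividends_le {R : realType} (at_ruin : bool) (delta : R)
    (tau : \bar R) (C C0 : cumulative R R) :
  (forall s t, s <= t -> C t - C s <= C0 t - C0 s) ->
  (discounted_dividends at_ruin delta tau C <=
   discounted_dividends at_ruin delta tau C0)%E.
Proof.
move=> CC0; apply: ge0_le_measure_integral.
- by move=> A mA; exact: lebesgue_stieltjes_measure_le.
- rewrite (_ : payment_times _ _ = `]0, +oo[ `&`
      EFin @^-1` [set` Interval -oo%O (BSide (~~ at_ruin) tau)]).
    apply: measurableI; first exact: measurable_itv.
    rewrite -[X in measurable X]setTI.
    by apply: EFin_measurable => //; exact: emeasurable_itv.
  apply/seteqP; rewrite /payment_times; case: at_ruin; split => t /=;
    by rewrite !in_itv/= ?andbT.
- by move=> t; rewrite lee_fin expR_ge0.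
- apply/measurable_EFinP; apply: (measurableT_comp (@measurable_expR R)).
  exact/measurable_funN/measurable_funM.
Qed.

Lemma discounted_dividends_ge0 {R : realType} (at_ruin : bool) (delta : R)
    (tau : \bar R) (C : cumulative R R) :
  (0 <= discounted_dividends at_ruin delta tau C)%E.
Proof. by apply: integral_ge0 => t _; rewrite lee_fin expR_ge0. Qed.

(** * The control with full proportional retention *)

Section full_proportional_retention.
Context {R : realType} {d : measure_display} {T : measurableType d}
  {d' : measure_display} {S : measurableType d'} {Q : probability S R}.
Variables (F : R -> set (set T)) (Y : 'I_2 -> {RV Q >-> R}) (kappa : 'I_2 -> R).
Hypothesis Fsigma : forall t, 0 <= t -> sigma_algebra setT (F t).
Hypothesis Y_ge0 : forall i w, 0 <= Y i w.
Hypothesis Y_moment1 : forall i, Q.-integrable setT (fun w => (Y i w)%:E).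
Hypothesis Y_moment2 : forall i, Q.-integrable setT (fun w => (Y i w ^+ 2)%:E).
Hypothesis kappa_gt0 : forall i, 0 < kappa i.
Let Fbar i := survival (Y i).
Variable u : @control R d T.
Hypothesis u_adm : admissible F Fbar u.
Hypothesis theta_lt1 : forall i t w, 0 <= t -> 0 < theta u i t w < 1.

Let mu_nd i := mu_of_nondecreasing (Y_ge0 i) (Y_moment1 i).
Let sigma_nd i := sigma_of_nondecreasing (Y_ge0 i) (Y_moment2 i).

Lemma excess_level_ge0 i t w : 0 <= t -> (0 <= excess_level u i t w)%E.
Proof.
move=> t0; have [_ _ /(_ t w t0)/andP[r0 _] _ _] := u_adm i.
by rewrite mule_ge0// lee_fin invr_ge0 ltW//; have /andP[] := theta_lt1 i w t0.
Qed.

(** Under full proportional retention, this retention reproduces the volatility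
    of the given control. *)
Definition equal_risk_retention i t w : \bar R :=
  risk_level (Y i) (volatility Fbar u i t w).

Lemma equal_risk_retentionP i t w : 0 <= t -> exists c, [/\ 0 <= c,
  sigma_of (Fbar i) c%:E = volatility Fbar u i t w,
  equal_risk_retention i t w = c%:E &
  (equal_risk_retention i t w <= claim_max (Fbar i))%E].
Proof.
move=> t0; have /andP[th0 th1] := theta_lt1 i w t0.
apply: (risk_levelP (Y_ge0 i) (Y_moment2 i)).
  by rewrite mulr_ge0 ?sigma_of_ge0 ?ltW.
have sy := sigma_nd i (leey (excess_level u i t w)).
have s0 := sigma_of_ge0 (Y i) (excess_level u i t w).
have sy0 := sigma_of_ge0 (Y i) +oo%E.
rewrite /volatility /Fbar; have [s|s] := leP (sigma_of (survival (Y i)) +oo%E) 0.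
  left; rewrite (_ : sigma_of _ _ = 0) ?mulr0//.
  by apply/eqP; rewrite eq_le s0 (le_trans sy).
right; apply: le_lt_trans (_ : _ <= theta u i t w * sigma_of (survival (Y i)) +oo%E) _.
  by rewrite ler_wpM2l// ltW.
by rewrite gtr_pMl.
Qed.

Definition drift_gain i t w : R :=
  kappa i * mu_of (Fbar i) (equal_risk_retention i t w) - drift kappa Fbar u i t w.

(** This is [theta_mu_le] at each instant and outcome. *)
Lemma drift_le i t w : 0 <= t ->
  0 <= drift kappa Fbar u i t w <=
    kappa i * mu_of (Fbar i) (equal_risk_retention i t w).
Proof.
move=> t0; have /andP[th0 th1] := theta_lt1 i w t0.
have [c [c0 sc -> _]] := equal_risk_retentionP i w t0.
rewrite /drift -mulrA; have k0 := kappa_gt0 i; apply/andP; split.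
  by rewrite !mulr_ge0 ?mu_of_ge0// ltW.
rewrite ler_pM2l//; apply: theta_mu_le => //; first by rewrite th0 ltW.
exact: excess_level_ge0.
Qed.

Let K i := kappa i * mu_of (Fbar i) +oo%E.

Lemma drift_bnd i t w : 0 <= t -> 0 <= drift kappa Fbar u i t w <= K i.
Proof.
move=> t0; have /andP[-> /le_trans] := drift_le i w t0; apply.
by rewrite ler_pM2l//; apply: mu_nd; exact: leey.
Qed.

Lemma drift_gain_bnd i t w : 0 <= t -> 0 <= drift_gain i t w <= K i.
Proof.
move=> t0; have /andP[d0 dl] := drift_le i w t0.
rewrite subr_ge0 dl lerBlDr ler_wpDr// ler_pM2l//.
by apply: mu_nd; exact: leey.
Qed.

Lemma progressive_excess_level i : progressive F (excess_level u i).
Proof.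
have [[pth pr] _ _ _ _] := u_adm i; apply: progressive_ediv => //.
by move=> t w t0; have /andP[] := theta_lt1 i w t0.
Qed.

Lemma progressive_equal_risk_retention i : progressive F (equal_risk_retention i).
Proof.
have [[pth pr] _ _ _ _] := u_adm i.
apply: (progressive_comp Fsigma (h := risk_level (Y i))).
  by apply: nondecreasing_measurable_ereal; exact: risk_level_nondecreasing.
apply: progressiveM => //.
apply: (progressive_comp Fsigma (h := sigma_of (Fbar i))).
  by apply: nondecreasing_emeasurable => s t; exact: sigma_nd.
exact: progressive_excess_level.
Qed.

Lemma progressive_mu_of i (r : R -> T -> \bar R) : progressive F r ->
  progressive F (fun t w => kappa i * mu_of (Fbar i) (r t w)).
Proof.
apply: (progressive_comp Fsigma (h := fun s => kappa i * mu_of (Fbar i) s)).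
apply: measurable_funM => //.
by apply: nondecreasing_emeasurable => s t; exact: mu_nd.
Qed.

Lemma progressive_drift i : progressive F (drift kappa Fbar u i).
Proof.
have [[pth pr] _ _ _ _] := u_adm i.
have := progressiveM Fsigma pth (progressive_mu_of i (progressive_excess_level i)).
congr progressive; apply/funext => t; apply/funext => w.
by rewrite /drift /= mulrCA mulrA.
Qed.

Lemma progressive_drift_gain i : progressive F (drift_gain i).
Proof.
apply: progressiveB => //; last exact: progressive_drift.
by apply: progressive_mu_of; exact: progressive_equal_risk_retention.
Qed.

(** The dividends of the improved control, as right-continuous nondecreasing
    paths on the whole line. *)
Lemma dividend_with_gain_exists : exists C0 : 'I_2 -> T -> cumulative R R,
  forall i w t, C0 i w t = dividend u i w t + running_integral (drift_gain i) w t.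
Proof.
have cum i w : exists g : cumulative R R,
    g =1 (fun t => dividend u i w t + running_integral (drift_gain i) w t).
  have bnd s v : 0 <= s -> 0 <= drift_gain i s v <= K i by exact: drift_gain_bnd.
  have pg := progressive_drift_gain i.
  apply: cumulative_exists.
    move=> s t st; apply: lerD; first exact: cumulative_is_nondecreasing.
    exact: running_integral_nondecreasing pg bnd _ _ _ st.
  move=> t; apply: cvgD; first exact: cumulative_is_right_continuous.
  exact: running_integral_right_continuous pg bnd _ _.
have [C0 C0E] := choice (fun iw => cum iw.1 iw.2).
by exists (fun i w => C0 (i, w)) => i w t; rewrite C0E.
Qed.

End full_proportional_retention.

Unset Implicit Arguments.

Theorem proposition3p2 (R : realType)
  (d : measure_display) (T : measurableType d) (P : probability T R)
  (F : R -> set (set T)) (W : 'I_2 -> R -> T -> R)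
  (d' : measure_display) (S : measurableType d') (Q : probability S R)
  (Y : 'I_2 -> {RV Q >-> R})
  (kappa : 'I_2 -> R) (delta a : R) (x : 'I_2 -> R) (at_ruin : bool)
  (Pcomplete : measure_is_complete P)
  (Fusual : usual_filtration P F)
  (WB : forall i, brownian_motion P F (W i))
  (Windep : independent_processes P (W ord0) (W ord_max))
  (Y_ge0 : forall i w, 0 <= Y i w)
  (Y_moment1 : forall i, Q.-integrable setT (fun w => (Y i w)%:E))
  (Y_moment2 : forall i, Q.-integrable setT (fun w => (Y i w ^+ 2)%:E))
  (kappa_gt0 : forall i, 0 < kappa i)
  (delta_gt0 : 0 < delta) (a01 : 0 <= a <= 1)
  (x_ge0 : forall i, 0 <= x i) :
  let Fbar i := survival (Y i) in
  forall u : control,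
    admissible F Fbar u ->
    (forall i t w, 0 <= t -> 0 < theta u i t w < 1) ->
    exists u0 : control,
      [/\ admissible F Fbar u0,
          forall i t w, 0 <= t -> theta u0 i t w = 1 &
          (J P F W kappa Fbar at_ruin delta a x u
             <= J P F W kappa Fbar at_ruin delta a x u0)%E].
Proof.
move=> Fbar u u_adm theta_lt1.
have Fsigma t : 0 <= t -> sigma_algebra setT (F t).
  by move=> t0; have [/(_ t t0)[]] := Fusual.
have [C0 C0E] := dividend_with_gain_exists Fsigma Y_ge0 Y_moment1 Y_moment2
  kappa_gt0 u_adm theta_lt1.
pose r0 := equal_risk_retention Y u; pose gain := drift_gain Y kappa u.
pose G i := running_integral (gain i).
pose u0 := Control (fun _ _ _ => 1) r0 C0 (transfer u).
have gbnd i s w : 0 <= s -> 0 <= gain i s w <= kappa i * mu_of (Fbar i) +oo%E.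
  exact: drift_gain_bnd.
have gprog i : progressive F (gain i) by exact: progressive_drift_gain.
have G_nd i w : nondecreasing (G i w).
  by exact: running_integral_nondecreasing (gprog i) (gbnd i) _.
have G0 i w : G i w 0 = 0 by rewrite /G /running_integral set_itv1 Rintegral_set1.
have exc0 i t w : excess_level u0 i t w = r0 i t w.
  by rewrite /excess_level /= invr1 mule1.
have vol0 i t w : 0 <= t -> volatility Fbar u i t w = volatility Fbar u0 i t w.
  move=> t0; rewrite [RHS]/volatility exc0 mul1r.
  have [c [_ <- rc _]] := equal_risk_retentionP Y_ge0 Y_moment2 theta_lt1 i w t0.
  by rewrite /r0 rc.
have drift0 i t w : drift kappa Fbar u0 i t w = drift kappa Fbar u i t w + gain i t w.
  by rewrite /drift exc0 mulr1 /gain /drift_gain addrCA /drift subrr addr0.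
have int_drift0 i t w :
    \int[@lebesgue_measure R]_(s in `[0, t]) drift kappa Fbar u0 i s w =
    \int[@lebesgue_measure R]_(s in `[0, t]) drift kappa Fbar u i s w + G i w t.
  rewrite -RintegralD//=; first by apply: eq_Rintegral => s _; exact: drift0.
    apply: (integrable_path Fsigma (K := kappa i * mu_of (Fbar i) +oo%E)).
      exact: progressive_drift.
    exact: drift_bnd.
  exact: (integrable_path Fsigma (gprog i) (gbnd i)).
(* The drift gained and the dividends added cancel in the state equation, and
   the volatilities agree: both controls have the same set of reserves. *)
have reserve0 : reserve P F W kappa Fbar x u = reserve P F W kappa Fbar x u0.
  rewrite /reserve; congr xget; apply/funext => X; apply/propext.
  have eqX Z i t w :
      (x i + \int[@lebesgue_measure R]_(s in `[0, t]) drift kappa Fbar u0 i s w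
        + Z i t w
        - increment (dividend u0 i) t w
        + increment (transfer u0 i) t w
        - increment (transfer u0 (rev_ord i)) t w)
    = (x i + \int[@lebesgue_measure R]_(s in `[0, t]) drift kappa Fbar u i s w
        + Z i t w
        - increment (dividend u i) t w
        + increment (transfer u i) t w
        - increment (transfer u (rev_ord i)) t w).
    rewrite int_drift0 /increment /= !C0E -/(gain i) -/(G i) G0; ring.
  split=> -[Z [ZI XE]]; exists Z; split.
  - by move=> i; apply: ito_integral_eq (ZI i) => s w; exact: vol0.
  - move: XE; apply: filterS => w Xw i t t0.
    by rewrite eqX; exact: Xw.
  - by move=> i; apply: ito_integral_eq (ZI i) => s w s0; rewrite vol0.
  - move: XE; apply: filterS => w Xw i t t0.
    by rewrite -eqX; exact: Xw.
exists u0; split; [| by [] |].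
- move=> i; have [[pth pr] _ _ [aC aL] CL0] := u_adm i; split.
  + split; first exact: progressive_cst.
    exact: progressive_equal_risk_retention.
  + by move=> t w _ /=; rewrite ltr01 lexx.
  + move=> t w t0 /=.
    have [c [c0 _ rc rM]] := equal_risk_retentionP Y_ge0 Y_moment2 theta_lt1 i w t0.
    by rewrite rM andbT /r0 rc lee_fin.
  + split => //.
    rewrite (_ : (fun t w => _) = (fun t w => dividend u i w t + G i w t)); last first.
      by apply/funext => t; apply/funext => w; exact: C0E.
    apply: adaptedD => //.
    exact: adapted_running_integral Fsigma _ _ (gprog i) (gbnd i).
  + move=> t w t0; have [d0 l0] := CL0 t w t0; split => //=.
    by rewrite C0E addr_ge0// -[leLHS](G0 i w); exact: G_nd.
- rewrite /J -reserve0; have /andP[a0 a1] := a01.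
  have dle tau i w : (discounted_dividends at_ruin delta tau (dividend u i w) <=
      discounted_dividends at_ruin delta tau (dividend u0 i w))%E.
    apply: discounted_dividends_le => s t st /=; rewrite !C0E.
    by have := G_nd i w _ _ st; rewrite /G /gain; lra.
  apply: ge0_le_integral_pointwise => w.
    by rewrite adde_ge0// mule_ge0 ?discounted_dividends_ge0// lee_fin ?subr_ge0.
  by apply: leeD; apply: lee_wpmul2l; rewrite ?lee_fin ?subr_ge0//.
Qed.
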